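(* Let $M\in\mathbb{R}^{(n+1)\times(n+1)}$ be a matrix of the form $$M=\begin{bmatrix}0 & v \\ v^T & \alpha\end{bmatrix},$$ where the upper-left block is $0\in\mathbb{R}^{n\times n}$, $v\in\mathbb{R}^n$ and $\alpha\in\mathbb{R}$. Then $M$ has $n-1$ zero eigenvalues and two additional eigenvalues $$\lambda_\pm=\frac{\alpha\pm\sqrt{\alpha^2+4v^Tv}}{2}$$ (eigenvalues counted with multiplicity). *)

(* Defs.v *)
From mathcomp Require Import all_boot all_algebra.

Set Implicit Arguments.
Unset Strict Implicit.
Unset Printing Implicit Defensive.

Import GRing.Theory.
Local Open Scope ring_scope.

(* Multiplicity is algebraic: the roots of the characteristic polynomial,
   which has to split over F. The order of s is irrelevant. *)
Definition eigenvalues_with_multiplicity (F : fieldType) (n : nat)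
    (M : 'M[F]_n) (s : seq F) : Prop :=
  char_poly M = \prod_(a <- s) ('X - a%:P).

Lemma mem_eigenvalues (F : fieldType) (n : nat) (M : 'M[F]_n) (s : seq F) :
  eigenvalues_with_multiplicity M s -> forall a, (a \in s) = eigenvalue M a.
Proof. by move=> Ms a; rewrite eigenvalue_root_char Ms root_prod_XsubC. Qed.

Lemma count_eigenvalues (F : fieldType) (n : nat) (M : 'M[F]_n) (s : seq F) :
  eigenvalues_with_multiplicity M s ->
  forall a, count_mem a s = mup a (char_poly M).
Proof. by move=> -> a; rewrite mu_prod_XsubC. Qed.

(* Main.v *)
(* Column-reduce the characteristic matrix: multiplying it on the right by
   [1, v; 0, X] clears its upper-right block, so that X * det(X - M) =
   X^n * (X^2 - alpha X - v^T v).  Cancelling X leaves X^(n-1) times a quadratic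
   whose roots are given by the usual formula. *)
Require Import Defs.
From mathcomp Require Import all_boot all_algebra.
From mathcomp Require Import reals ring.

Set Implicit Arguments.
Unset Strict Implicit.
Unset Printing Implicit Defensive.

Import GRing.Theory Num.Theory.
Local Open Scope ring_scope.

(** The factor ['X] is kept on the left so that no exponent [n - 1] appears; the identity then also
    covers [n = 0]. *)
Lemma char_poly_bordered0 (F : idomainType) (n : nat) (v : 'cV[F]_n) (a : F) :
  'X * char_poly (block_mx 0 v v^T a%:M : 'M_(n + 1)) =
  'X^n * ('X^2 - a *: 'X - ((v^T *m v) 0 0)%:P).
Proof.
pose w : 'cV[{poly F}]_n := map_mx polyC v.
have cpE : char_poly_mx (block_mx 0 v v^T a%:M : 'M_(n + 1)) =
    block_mx 'X%:M (- w) (- w^T) ('X - a%:P)%:M.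
  rewrite /char_poly_mx map_block_mx map_mx0 map_scalar_mx -map_trmx.
  by rewrite scalar_mx_block opp_block_mx add_block_mx !sub0r subr0 raddfB.
have prodE : block_mx 'X%:M (- w) (- w^T) ('X - a%:P)%:M
      *m block_mx 1%:M w 0 'X%:M =
    block_mx 'X%:M 0 (- w^T) ('X^2 - a *: 'X - ((v^T *m v) 0 0)%:P)%:M.
  rewrite mulmx_block !mulmx1 !mulmx0 !addr0 mul_scalar_mx mul_mx_scalar scalerN.
  rewrite subrr mulNmx -scalar_mxM; congr block_mx.
  have -> : w^T *m w = ((v^T *m v) 0 0)%:P%:M.
    by rewrite /w map_trmx -map_mxM [v^T *m v]mx11_scalar map_scalar_mx !mxE.
  by rewrite addrC -raddfB mulrBl -mul_polyC expr2.
(* Both factors of block-triangular shape have a lower-right block of size 1, so their determinants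
   are ['X] and ['X^n] times the quadratic. *)
move/(congr1 determinant): prodE.
rewrite det_mulmx det_ublock det_lblock det1 mul1r !det_scalar expr1 -cpE.
by rewrite expr1 mulrC.
Qed.

Theorem lemma4 (R : realType) (n : nat) (hn : (1 <= n)%N)
    (v : 'cV[R]_n) (alpha : R) (M : 'M[R]_(n + 1))
    (hM : M = block_mx 0 v v^T alpha%:M) :
  let delta : R := Num.sqrt (alpha ^+ 2 + 4 * (v^T *m v) 0 0) in
  let lambda_plus : R := (alpha + delta) / 2 in
  let lambda_minus : R := (alpha - delta) / 2 in
  eigenvalues_with_multiplicity M
    (nseq (n - 1) 0 ++ [:: lambda_plus; lambda_minus]).
Proof.
move=> delta lp lm; rewrite /eigenvalues_with_multiplicity.
(* [Num.sqrt] is 0 on negative reals, so squaring [delta] back requires a nonnegative radicand. *)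
have vv_ge0 : 0 <= (v^T *m v) 0 0.
  by rewrite mxE sumr_ge0 // => i _; rewrite mxE -expr2 sqr_ge0.
have deltaE : delta ^+ 2 = alpha ^+ 2 + 4 * (v^T *m v) 0 0.
  by rewrite sqr_sqrtr // addr_ge0 ?sqr_ge0 ?mulr_ge0.
(* By Vieta, the sum and product of the roots determine the quadratic. *)
have sumE : lp + lm = alpha by rewrite /lp /lm; field.
have prodE : lp * lm = - (v^T *m v) 0 0.
  have -> : lp * lm = (alpha ^+ 2 - delta ^+ 2) / 4 by rewrite /lp /lm; field.
  by rewrite deltaE; field.
have X_neq0 : 'X != 0 :> {poly R} by rewrite polyX_eq0.
apply: (mulfI X_neq0); rewrite hM char_poly_bordered0.
rewrite big_cat big_cons big_seq1 big_nseq polyC0 subr0.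
(* The truncated [n - 1] is harmless by [hn]: the extra ['X] restores ['X^n]. *)
rewrite iter_mulr_1 mulrA -exprS subn1 prednK //; congr (_ * _).
rewrite -sumE -[_ 0 0]opprK -prodE -mul_polyC.
(* What remains is a polynomial identity in arbitrary [p] and [q]. *)
move: lp lm {sumE prodE} => p q; rewrite !(polyCD, polyCN, polyCM).
by rewrite /=; ring.
Qed.
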